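(* For all $1\le m\le n$ and $k\ge1$, the variety $\mathcal Z^{m,n}_{m,k}$ (all maximal minors set to zero) is irreducible, of codimension $k(n-m+1)$ in $\mathbf A^{mnk}$.
   Context: Let $F$ be an algebraically closed field. For integers $1\le r\le m\le n$ and $k\ge 1$, let $S=F[x^{(l)}_{i,j}:1\le i\le m,\ 1\le j\le n,\ 0\le l\le k-1]$, the coordinate ring of $\mathbf A^{mnk}_F$, and let $X(t)$ be the $m\times n$ matrix over $S[t]/(t^k)$ with $(i,j)$ entry $x_{i,j}(t)=\sum_{l=0}^{k-1}x^{(l)}_{i,j}t^l$. Every element of $S[t]/(t^k)$ is uniquely $\sum_{l=0}^{k-1}c_lt^l$ with $c_l\in S$ (its coefficient of $t^l$). $\mathcal I^{m,n}_{r,k}\subseteq S$ is the ideal generated by the coefficients of $t^l$, $0\le l\le k-1$, of all $r\times r$ minors of $X(t)$, and $\mathcal Z^{m,n}_{r,k}\subseteq\mathbf A^{mnk}_F$ is its zero set. *)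

(* Defs.v *)
From HB Require Import structures.
From mathcomp Require Import all_boot all_order all_algebra.
From mathcomp Require Import mpoly.
Set Implicit Arguments. Unset Strict Implicit. Unset Printing Implicit Defensive.
Import Order.TTheory GRing.Theory.
Local Open Scope ring_scope.

Definition pt (F : fieldType) (N : nat) := ('I_N -> F)%type.

Definition zero_set (F : fieldType) (N : nat) (S : {mpoly F[N]} -> Prop)
  : pt F N -> Prop := fun v => forall p, S p -> p.@[v] = 0.

Definition zclosed (F : fieldType) (N : nat) (A : pt F N -> Prop) : Prop :=
  exists S : {mpoly F[N]} -> Prop, forall v, A v <-> zero_set S v.

Definition irreducible_set (F : fieldType) (N : nat) (A : pt F N -> Prop) : Prop :=
  (exists v, A v) /\
  forall B C : pt F N -> Prop, zclosed B -> zclosed C ->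
    (forall v, A v -> B v \/ C v) ->
    (forall v, A v -> B v) \/ (forall v, A v -> C v).

Definition subset_strict (F : fieldType) (N : nat) (A B : pt F N -> Prop) : Prop :=
  (forall v, A v -> B v) /\ exists v, B v /\ ~ A v.

Definition irr_chain (F : fieldType) (N : nat) (A : pt F N -> Prop)
  (d : nat) (Z : nat -> pt F N -> Prop) : Prop :=
  (forall i, (i <= d)%N -> zclosed (Z i) /\ irreducible_set (Z i) /\
                          forall v, Z i v -> A v) /\
  (forall i, (i < d)%N -> subset_strict (Z i) (Z i.+1)).

Definition zdim (F : fieldType) (N : nat) (A : pt F N -> Prop) (d : nat) : Prop :=
  (exists Z, irr_chain A d Z) /\ ~ (exists Z, irr_chain A d.+1 Z).

Definition nvars (m n k : nat) : nat := #|{: 'I_m * 'I_n * 'I_k}|.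

Definition xvar (F : fieldType) (m n k : nat) (i : 'I_m) (j : 'I_n) (l : 'I_k)
  : {mpoly F[nvars m n k]} := 'X_(enum_rank (i, j, l)).

Definition Xt (F : fieldType) (m n k : nat) : 'M[{poly {mpoly F[nvars m n k]}}]_(m, n) :=
  \matrix_(i < m, j < n) \sum_(l < k) (xvar F i j l) *: 'X^l.

Definition incr (r p : nat) (f : 'I_r -> 'I_p) : Prop :=
  forall a b : 'I_r, (a < b)%N -> (f a < f b)%N.

Definition minor (F : fieldType) (m n k r : nat) (f : 'I_r -> 'I_m) (g : 'I_r -> 'I_n)
  : {poly {mpoly F[nvars m n k]}} := \det (mxsub f g (Xt F m n k)).

(* generators of I^{m,n}_{r,k}: the coefficients of t^l, l < k, of all r x r
   minors (computing in S[t] and reading coefficients l < k is the same as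
   computing in S[t]/(t^k)) *)
Definition Igens (F : fieldType) (m n r k : nat) (p : {mpoly F[nvars m n k]}) : Prop :=
  exists (f : 'I_r -> 'I_m) (g : 'I_r -> 'I_n) (l : nat),
    [/\ incr f, incr g, (l < k)%N & p = (@minor F m n k r f g)`_l].

Definition Zjet (F : fieldType) (m n r k : nat) : pt F (nvars m n k) -> Prop :=
  zero_set (@Igens F m n r k).

(* Main.v *)
Require Import Defs.
From HB Require Import structures.
From mathcomp Require Import all_boot all_order all_algebra all_fingroup.
From mathcomp Require Import mpoly zify.
From Stdlib Require Import Classical FunctionalExtensionality.
Set Implicit Arguments. Unset Strict Implicit. Unset Printing Implicit Defensive.
Import Order.TTheory GRing.Theory.
Local Open Scope ring_scope.

(* Write [m = 1 + m'].  The map [psi (w, B) = [w B; B]] from pairs of a row [w]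
   and an [m' x n] block [B] over [F[t]/(t^k)] has [k m' (n + 1)] parameters,
   which is the expected dimension, and lands in the variety because its first
   row is a combination of the others.

   Its image is dense.  Given a jet [A] with vanishing maximal minors, column
   operations over [F[t]] make [A Q] lower triangular.  Adding [s] times the
   subdiagonal matrix [N] to [A Q] does not change the determinant of the first
   [m] columns, which is 0 modulo [t^k], while the minor on the last [m'] rows
   and first [m'] columns becomes, modulo [t], a characteristic polynomial in
   [s].  So for all but finitely many [s] the first row of [A + s N Q^-1] is a
   combination of the others, and [A] is the value at [s = 0] of a line which
   is generically in the image.

   Irreducibility follows by restricting polynomials to lines of the parameter
   space.  A chain of [l + 1] irreducible closed sets yields [l] functions that
   are algebraically independent on the largest of them; pulled back along
   [psi] there can be at most as many as parameters.  Conversely, freeing the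
   parameters one after the other, starting from [w = 0], [B = [I 0]], gives a
   chain of the right length, separated by coordinate functions. *)

(** * Determinants of products and of column selections *)

(** The determinant is multilinear in the columns of the product, each a combination of columns of
    [A]. This is Cauchy-Binet before terms are collected, enough to obtain a combination of maximal
    minors of [A]. *)
Lemma det_mulmx_sum_colsub (R : comNzRingType) (m n : nat)
    (A : 'M[R]_(m, n)) (B : 'M[R]_(n, m)) :
  \det (A *m B) =
  \sum_(f : {ffun 'I_m -> 'I_n}) \det (colsub f A) * \prod_i B (f i) i.
Proof.
rewrite -det_tr /determinant.
under eq_bigr => s _.
  under eq_bigr => i _ do rewrite !mxE.
  rewrite (bigA_distr_bigA (fun i j => A (s i) j * B j i)) big_distrr /=.
  over.
rewrite exchange_big /=; apply: eq_bigr => f _.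
rewrite -[X in X * _]/(\det (colsub f A)) -det_tr /determinant big_distrl /=.
apply: eq_bigr => s _; rewrite big_split /= mulrA; congr (_ * _ * _).
by apply: eq_bigr => i _; rewrite !mxE.
Qed.

(** A repeated column gives determinant 0, and sorting distinct columns changes only the sign, so
    increasing choices control all others. *)
Lemma det_colsub_incr (R : comNzRingType) (P : R -> Prop) (m n : nat)
    (A : 'M[R]_(m, n)) :
  P 0 -> (forall x, P x -> P (- x)) ->
  (forall g : 'I_m -> 'I_n, incr g -> P (\det (colsub g A))) ->
  forall g : 'I_m -> 'I_n, P (\det (colsub g A)).
Proof.
move=> P0 PN Pincr g.
have [/injectiveP g_inj|] := boolP (injectiveb g); last first.
  case/injectivePn=> i [j ij gij]; rewrite -det_tr (determinant_alternate ij) //.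
  by move=> l; rewrite !mxE gij.
pose s := sort_tuple (fun a b : 'I_n => (a <= b)%N) [tuple g i | i < m].
have /tuple_permP [p sE] : perm_eq s [tuple g i | i < m].
  by rewrite perm_sort perm_refl.
have tE i : tnth s i = g (p i).
  rewrite -(tnth_mktuple g (p i)) -(tnth_mktuple (fun j => tnth [tuple g i | i < m] (p j)) i).
  by congr tnth; apply: val_inj.
have h_incr : incr (fun i => g (p i)).
  move=> a b ab; rewrite ltn_neqAle; apply/andP; split.
    apply: contraTneq ab => /val_inj/g_inj/perm_inj ->.
    by rewrite ltnn.
  rewrite -!tE (tnth_nth (g a)) (tnth_nth (g a)).
  apply: (@sorted_leq_nth _ (fun a b : 'I_n => (a <= b)%N)).
  - by move=> y x z; apply: leq_trans.
  - by move=> x; apply: leqnn.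
  - by apply: sort_sorted => x y; apply: leq_total.
  - by rewrite inE size_tuple.
  - by rewrite inE size_tuple.
  - exact: ltnW.
have := Pincr _ h_incr.
have -> : colsub (fun i => g (p i)) A = col_perm p (colsub g A).
  by apply/matrixP => i j; rewrite !mxE.
rewrite col_permE det_mulmx det_perm mulrC.
by case: (odd_perm _); rewrite ?expr1 ?expr0 ?mul1r // mulN1r => /PN; rewrite opprK.
Qed.

(** * Lower triangular form by column operations over [F[t]] *)

Section ColumnReduction.

Variable F : fieldType.

(** The four polynomials form a 2 x 2 matrix of determinant 1 sending the row [(a, b)] to one with
    second entry 0. When [a] and [b] are both 0 there is no gcd to divide by, and the identity
    matrix serves. *)
Lemma poly_bezout_cofactors (a b : {poly F}) : exists u v a' b' : {poly F},
  u * a' + v * b' = 1 /\ a * b' = b * a'.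
Proof.
have [/andP [/eqP -> /eqP ->]|ab0] := boolP ((a == 0) && (b == 0)).
  by exists 1, 0, 1, 0; rewrite !mul0r mulr1 addr0.
have [[u v] /= uvg] := Bezoutp a b.
have g0 : gcdp a b != 0 by rewrite gcdp_eq0.
have h0 : u * a + v * b != 0 by rewrite -size_poly_eq0 (eqp_size uvg) size_poly_eq0.
set h := u * a + v * b in uvg h0.
have /dvdpP [a' aE] : h %| a by rewrite (eqp_dvdl _ uvg) dvdp_gcdl.
have /dvdpP [b' bE] : h %| b by rewrite (eqp_dvdl _ uvg) dvdp_gcdr.
exists u, v, a', b'; split; last by rewrite aE bE mulrAC [RHS]mulrAC (mulrC a').
by apply: (mulIf h0); rewrite mulrDl -!mulrA -aE -bE mul1r.
Qed.

Lemma row_reduction n (a : 'rV[{poly F}]_(1 + n)) :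
  exists2 Q, Q \in unitmx & rsubmx (a *m Q) = 0.
Proof.
elim: n a => [|n IHn] a.
  by exists 1%:M; [exact: unitmx1|rewrite thinmx0].
rewrite -[n.+1]/(1 + n)%N in a *.
have [Q Qu Q0] := IHn (rsubmx a).
set c := lsubmx (rsubmx a *m Q : 'rV_(1 + n)).
have [u [v [a' [b' [uv1 ab]]]]] := poly_bezout_cofactors (a 0 0) (c 0 0).
(* [M x y z w] acts as a 2 x 2 matrix on the first two coordinates and as the identity on the
   others. *)
pose M (x y z w : {poly F}) : 'M[{poly F}]_(1 + (1 + n)) :=
  block_mx x%:M (row_mx y%:M 0) (col_mx z%:M 0) (block_mx w%:M 0 0 1%:M).
pose Q1 : 'M[{poly F}]_(1 + (1 + n)) := block_mx 1%:M 0 0 Q.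
have MV : M u (- b') v a' *m M a' b' (- v) u = 1%:M.
  rewrite /M mulmx_block !mul_row_col !mul_mx_row !mul_col_mx !mulmx0 !mul0mx.
  rewrite !(mul_row_block, mul_col_row, mul_block_col, mulmx_block).
  rewrite !(mulmx0, mul0mx, addr0, add0r, mulmx1, mul1mx).
  rewrite !mul_row_col !mulmx0 !mul0mx -block_mxEh.
  rewrite -[col_mx (row_mx _ _) _]block_mxEv.
  rewrite -!scalar_mxM (add_block_mx (v * b')%:M) !(addr0, add0r, row_mx0).
  rewrite !add_row_mx !add_col_mx !(addr0, add0r) -!raddfD /=.
  rewrite !mulNr !mulrN opprK (mulrC b' v) uv1 (mulrC u b') addrN.
  rewrite (mulrC a' v) addrN (mulrC a' u) [v * b' + _]addrC uv1 !raddf0 col_mx0 row_mx0.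
  by rewrite -!scalar_mx_block.
exists (Q1 *m M u (- b') v a').
  rewrite unitmx_mul; apply/andP; split; last by case/mulmx1_unit: MV.
  by rewrite unitmxE det_ublock det1 mul1r -unitmxE.
have aE : a = row_mx (a 0 0)%:M (rsubmx a).
  rewrite -[LHS]hsubmxK; congr row_mx; apply/matrixP => i j.
  by rewrite !ord1 !mxE mulr1n; congr (a _ _); apply: val_inj.
rewrite mulmxA aE mul_row_block !mulmx0 mulmx1 addr0 add0r.
rewrite -[rsubmx a *m Q]hsubmxK Q0 -/c mul_row_block row_mxKr.
rewrite mul_row_block !mulmx0 mul0mx mul_mx_row mulmx0 !addr0 add_row_mx addr0.
rewrite [c]mx11_scalar -!scalar_mxM -raddfD /=.
by rewrite mulrN ab addNr raddf0 row_mx0.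
Qed.

Lemma column_reduction m n (A : 'M[{poly F}]_(m, n)) :
  exists2 Q, Q \in unitmx & is_trig_mx (A *m Q).
Proof.
elim: m n A => [|m IHm] [|n] A; try by
  exists 1%:M; [exact: unitmx1|apply/is_trig_mxP;
    case=> i i_lt; case=> j j_lt].
rewrite -[n.+1]/(1 + n)%N -[m.+1]/(1 + m)%N in A *.
have [Q1 Q1u Q10] := row_reduction (usubmx A).
set B := A *m Q1.
have [Q2 Q2u Q2t] := IHm _ (drsubmx B).
exists (Q1 *m block_mx 1%:M 0 0 Q2).
  by rewrite unitmx_mul Q1u unitmxE det_ublock det1 mul1r -unitmxE.
have ur0 : ursubmx B = 0 by rewrite /ursubmx /B -mul_usub_mx.
rewrite mulmxA -/B -[B]submxK ur0 mulmx_block !mulmx0 !mul0mx !addr0 add0r.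
by rewrite is_trig_block_mx // eqxx mx11_is_trig.
Qed.

End ColumnReduction.

(** * Congruence modulo ['X^k] *)

(** This replaces the quotient ring, so that computations stay in a polynomial ring, where gcds are
    available over a field. *)
Definition eqmodX (R : nzRingType) (k : nat) (p q : {poly R}) :=
  forall l, (l < k)%N -> p`_l = q`_l.

Lemma eqmodX_sum (R : nzRingType) (k : nat) (I : Type) (r : seq I) (P : pred I)
    (f g : I -> {poly R}) :
  (forall i, P i -> eqmodX k (f i) (g i)) ->
  eqmodX k (\sum_(i <- r | P i) f i) (\sum_(i <- r | P i) g i).
Proof. by move=> fg l lk; rewrite !coef_sum; apply: eq_bigr => i Pi; apply: fg. Qed.

Lemma eqmodXM (R : nzRingType) (k : nat) (p p' q q' : {poly R}) :
  eqmodX k p p' -> eqmodX k q q' -> eqmodX k (p * q) (p' * q').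
Proof.
move=> pp qq l lk; rewrite !coefM; apply: eq_bigr => i _.
rewrite pp ?qq //; first exact: leq_ltn_trans (leq_subr _ _) lk.
by apply: leq_ltn_trans lk; rewrite -ltnS.
Qed.

Lemma eqmodX_mul0l (R : nzRingType) (k : nat) (p q : {poly R}) :
  eqmodX k p 0 -> eqmodX k (p * q) 0.
Proof. by move=> p0; rewrite -(mul0r q); apply: eqmodXM. Qed.

Lemma eqmodX_mul0r (R : nzRingType) (k : nat) (p q : {poly R}) :
  eqmodX k q 0 -> eqmodX k (p * q) 0.
Proof. by move=> q0; rewrite -(mulr0 p); apply: eqmodXM. Qed.

Lemma eqmodX_sum0 (R : nzRingType) (k : nat) (I : Type) (r : seq I) (P : pred I)
    (f : I -> {poly R}) :
  (forall i, P i -> eqmodX k (f i) 0) -> eqmodX k (\sum_(i <- r | P i) f i) 0.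
Proof.
by move=> f0 l lk; rewrite coef_sum coef0 big1 // => i /f0 ->; rewrite ?coef0.
Qed.

Lemma eqmodX_det (R : comNzRingType) (k m : nat) (A B : 'M[{poly R}]_m) :
  (forall i j, eqmodX k (A i j) (B i j)) -> eqmodX k (\det A) (\det B).
Proof.
move=> AB; apply: eqmodX_sum => s _; apply: eqmodXM => //.
by elim/big_rec2: _ => // i p q _; apply: eqmodXM.
Qed.

Lemma eqmodX_mulmx (R : nzRingType) (k m n p : nat)
    (A A' : 'M[{poly R}]_(m, n)) (B B' : 'M[{poly R}]_(n, p)) :
  (forall i j, eqmodX k (A i j) (A' i j)) ->
  (forall i j, eqmodX k (B i j) (B' i j)) ->
  forall i j, eqmodX k ((A *m B) i j) ((A' *m B') i j).
Proof.
by move=> AA BB i j; rewrite !mxE; apply: eqmodX_sum => l _; apply: eqmodXM.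
Qed.

(** * Syzygies after a generic perturbation *)

Section GenericSyzygy.

Variable F : fieldType.

Lemma generic_syzygy (k m n : nat) (A : 'M[{poly F}]_(m.+1, n)) :
  (m < n)%N -> (forall g, eqmodX k (\det (colsub g A)) 0) ->
  exists (E : 'M[{poly F}]_(m.+1, n)) (G : {poly F}), G != 0 /\
    forall s, G.[s] != 0 -> exists u : 'rV[{poly F}]_m.+1, (u 0 0).[0] != 0 /\
      forall i j, eqmodX k ((u *m (A + s%:P *: E)) i j) 0.
Proof.
move=> mn Adet; have [Q Qu /is_trig_mxP Lt] := column_reduction A.
set L := A *m Q in Lt.
pose N : 'M[{poly F}]_(m.+1, n) := \matrix_(i, j) (i == j.+1 :> nat)%:R.
pose h : 'I_m.+1 -> 'I_n := widen_ord mn.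
(* Deleting the first row and the last column moves the subdiagonal of [N] onto the diagonal. At
   [t = 0] the resulting minor of [L + s N] is [\det (K + s)], the characteristic polynomial of
   [- K] at [s]. *)
pose K := map_mx (horner_eval 0) (row' 0 (col' ord_max (colsub h L))).
exists (N *m invmx Q), (char_poly (- K)); split=> [|s Gs].
  exact/monic_neq0/char_poly_monic.
set Ls := L + s%:P *: N; set D := colsub h Ls.
have LsE i j : Ls i j = L i j + s%:P * (i == j.+1 :> nat)%:R.
  by rewrite mxE; congr (_ + _); rewrite !mxE.
have Lst (i : 'I_m.+1) (j : 'I_n) : (i < j)%N -> Ls i j = 0.
  by move=> ij; rewrite LsE Lt // add0r (ltn_eqF (leqW ij)) mulr0.
have detD : \det D = \det (colsub h L).
  rewrite det_trig; last by apply/is_trig_mxP => i j ij; rewrite mxE Lst.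
  rewrite det_trig; last by apply/is_trig_mxP => i j ij; rewrite mxE Lt.
  by apply: eq_bigr => i _; rewrite [LHS]mxE [RHS]mxE LsE /= (ltn_eqF (ltnSn i)) mulr0 addr0.
have detL : eqmodX k (\det (colsub h L)) 0.
  have -> : colsub h L = A *m colsub h Q.
    by apply/matrixP => i j; rewrite !mxE; apply: eq_bigr => l _; rewrite !mxE.
  rewrite det_mulmx_sum_colsub; apply: eqmodX_sum0 => f _.
  exact/eqmodX_mul0l/Adet.
(* The last row of the adjugate times [D] is [(0, ..., 0, \det D)], zero modulo ['X^k], and the
   columns of [Ls] beyond [D] vanish. The first entry of this row is, up to sign, the minor computed
   through [K]. *)
exists (row ord_max (\adj D)); split.
  have -> : (row ord_max (\adj D)) 0 0 = cofactor D 0 ord_max by rewrite !mxE.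
  rewrite /cofactor -/(horner_eval 0 _) rmorphM rmorphXn rmorphN1 mulf_neq0 //=.
    by rewrite signr_eq0.
  suff -> : horner_eval 0 (\det (row' 0 (col' ord_max D))) = (char_poly (- K)).[s] by [].
  rewrite /char_poly -/(horner_eval s _) -!det_map_mx; congr (\det _).
  apply/matrixP => i j; rewrite !mxE /= /horner_eval !hornerE.
  have -> : (i == j) = (bump 0 i == (bump m j).+1) :> bool.
    by rewrite /bump leq0n add1n eqSS leqNgt ltn_ord add0n.
  by case: eqP => _; rewrite !hornerE opprK // addrC.
have -> : A + s%:P *: (N *m invmx Q) = Ls *m invmx Q.
  by rewrite mulmxDl -scalemxAl -mulmxA mulmxV // mulmx1.
rewrite mulmxA => i j; rewrite mxE; apply: eqmodX_sum0 => a _; apply: eqmodX_mul0l.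
have [am|am] := ltnP a m.+1; last first.
  by rewrite mxE big1 // => b _; rewrite Lst ?mulr0 // (leq_trans (ltn_ord b)).
have -> : (row ord_max (\adj D) *m Ls) i a = (\det D)%:M ord_max (Ordinal am).
  rewrite -mul_adj_mx mxE [RHS]mxE; apply: eq_bigr => b _; congr (_ * _).
    by rewrite mxE.
  by rewrite [RHS]mxE; congr (Ls _ _); apply: val_inj.
rewrite detD => b bk; rewrite mxE; case: eqP => // _.
  by rewrite mulr1n detL.
Qed.

Lemma syzygy_row_combination (k m n : nat) (M : 'M[{poly F}]_(1 + m, n))
    (u : 'rV[{poly F}]_(1 + m)) :
  (u 0 0).[0] != 0 -> (forall i j, eqmodX k ((u *m M) i j) 0) ->
  exists w : 'rV[{poly F}]_m, forall i j,
    eqmodX k (M i j) ((col_mx (w *m dsubmx M) (dsubmx M)) i j).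
Proof.
move=> u0 uM.
have : coprimep (u 0 0) ('X^k) by rewrite coprimep_expr // coprimepX.
case/Bezout_eq1_coprimepP=> -[e f] /= ef.
(* [e] inverts the first entry of [u] modulo ['X^k], so the relation can be solved for the first
   row. *)
exists (- e *: rsubmx u) => i j l lk.
rewrite -[M in LHS]vsubmxK; case: (split_ordP i) => i' ->; last by rewrite !col_mxEd.
rewrite !col_mxEu ord1; apply/eqP; rewrite -subr_eq0 -coefB; apply/eqP.
have -> : (usubmx M) 0 j - (- e *: rsubmx u *m dsubmx M) 0 j =
  e * (u *m M) 0 j + f * (usubmx M) 0 j * 'X^k.
  have uME : (u *m M) 0 j = u 0 0 * (usubmx M) 0 j + (rsubmx u *m dsubmx M) 0 j.
    rewrite -[u in LHS]hsubmxK -[M in LHS]vsubmxK mul_row_col mxE; congr (_ + _).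
    rewrite mxE big_ord1; congr (_ * _); rewrite mxE; congr (u _ _); exact: val_inj.
  rewrite uME -scalemxAl [X in _ - X]mxE.
  rewrite -{1}[usubmx M 0 j]mul1r -ef mulrDl mulrDr mulNr opprK -mulrA addrAC.
  by rewrite mulrAC.
rewrite coefD coefMXn lk addr0.
by have := eqmodX_mul0r e (uM 0 j); move/(_ l lk); rewrite coef0.
Qed.

End GenericSyzygy.

(** * Substitution in multivariate polynomials *)

Lemma rmorph_mmap (n : nat) (R : nzRingType) (S S' : comNzRingType)
    (f : R -> S) (h : 'I_n -> S) (g : {rmorphism S -> S'}) (p : {mpoly R[n]}) :
  g (mmap f h p) = mmap (g \o f) (g \o h) p.
Proof.
rewrite /mmap rmorph_sum; apply: eq_bigr => m _.
rewrite rmorphM /mmap1 rmorph_prod; congr (_ * _).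
by apply: eq_bigr => i _; rewrite rmorphXn.
Qed.

Lemma meval_mmap (F : comNzRingType) (n d : nat) (g : 'I_n -> {mpoly F[d]})
    (p : {mpoly F[n]}) (x : 'I_d -> F) :
  (mmap (@mpolyC d F) g p).@[x] = p.@[fun i => (g i).@[x]].
Proof.
rewrite (rmorph_mmap _ _ (meval x)) /meval /mmap; apply: eq_bigr => m _.
by congr (_ * _); apply: mevalC.
Qed.

Lemma mmap_mmap (F : comNzRingType) (n d e : nat) (g : 'I_n -> {mpoly F[d]})
    (h : 'I_d -> {mpoly F[e]}) (p : {mpoly F[n]}) :
  mmap (@mpolyC e F) h (mmap (@mpolyC d F) g p) =
  mmap (@mpolyC e F) (fun i => mmap (@mpolyC e F) h (g i)) p.
Proof.
rewrite (rmorph_mmap _ _ (mmap (@mpolyC e F) h)) /mmap; apply: eq_bigr => m _.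
by congr (_ * _); apply: mmapC.
Qed.

Lemma meval_line (F : comNzRingType) (n : nat) (p : {mpoly F[n]}) (v e : 'I_n -> F) :
  exists r : {poly F}, forall s, r.[s] = p.@[fun i => v i + s * e i].
Proof.
exists (mmap polyC (fun i => (v i)%:P + e i *: 'X) p) => s.
rewrite -/(horner_eval s _) (rmorph_mmap _ _ (horner_eval s)) /meval /mmap.
apply: eq_bigr => m _; rewrite /= /horner_eval hornerC; congr (_ * _).
by apply: mmap1_eq => i /=; rewrite !hornerE mulrC.
Qed.

Local Notation widen := (widen_ord (leqnSn _)).

(** Splitting off the last variable lets functions be adjoined one at a time to an independent
    family. *)
Lemma mmap_muni (R S : comNzRingType) (n : nat) (f : {rmorphism R -> S})
    (h : 'I_n.+1 -> S) (p : {mpoly R[n.+1]}) :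
  mmap f h p = (map_poly (mmap f (fun i => h (widen i))) (muni p)).[h ord_max].
Proof.
rewrite muniE rmorph_sum horner_sum /mmap; apply: eq_bigr => m _.
rewrite /= map_polyZ map_polyXn hornerZ hornerXn /= mmapZ mmapX.
rewrite -mulrA /mmap1 big_ord_recr /=; congr (_ * (_ * _)).
by apply: eq_bigr => i _; rewrite mnmE.
Qed.

Lemma muni_eq0 (R : comNzRingType) (n : nat) (p : {mpoly R[n.+1]}) :
  muni p = 0 -> p = 0.
Proof.
move=> p0.
have pE : p = mmap (@mpolyC n.+1 R) (fun i => 'X_i) p.
  rewrite {1}[p]mpolyE; apply: eq_bigr => m _.
  by rewrite mmap1_id mul_mpolyC.
by rewrite pE mmap_muni p0 rmorph0 horner0.
Qed.

(** * Algebraic dependence of [d + 1] polynomials in [d] variables *)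

Section AlgebraicDependence.

Variable F : fieldType.

(** [msize] is the degree plus one, or 0 for the zero polynomial; bounds of the form [a.+1] make
    degrees add and cover the zero case. *)
Lemma msize_mul_leq (n a b : nat) (p q : {mpoly F[n]}) :
  (msize p <= a.+1 -> msize q <= b.+1 -> msize (p * q) <= (a + b).+1)%N.
Proof.
move=> pa qb; have [->|p0] := eqVneq p 0; first by rewrite mul0r msize0.
have [->|q0] := eqVneq q 0; first by rewrite mulr0 msize0.
rewrite msizeM // -subn1 leq_subLR add1n -addnS -addSn.
exact: leq_add.
Qed.

Lemma msize_prod_leq (n : nat) (I : Type) (r : seq I) (a : I -> nat)
    (p : I -> {mpoly F[n]}) :
  (forall i, msize (p i) <= (a i).+1)%N ->
  (msize (\prod_(i <- r) p i) <= (\sum_(i <- r) a i).+1)%N.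
Proof.
move=> pa; elim/big_rec2: _ => [|i x q _ IH]; first by rewrite msize1.
exact: msize_mul_leq.
Qed.

Lemma card_bmultinom_leq (n b : nat) : (#|{: 'X_{1..n < b}}| <= b ^ n)%N.
Proof.
rewrite -[n in (_ ^ n)%N]card_ord -[b in (b ^ _)%N]card_ord -card_ffun.
have mb (m : 'X_{1..n < b}) (i : 'I_n) : (m i < b)%N.
  apply: leq_ltn_trans (bmdeg m); rewrite mdegE (bigD1 i) //=; exact: leq_addr.
apply: (@leq_card _ _ (fun m : 'X_{1..n < b} => [ffun i => Ordinal (mb m i)])).
move=> m1 m2 /ffunP m12; apply: val_inj; apply/mnmP => i.
by have := congr1 val (m12 i); rewrite !ffunE.
Qed.

(* Count: the exponents below [M] give [M ^ d.+1] monomials in the [g i], whose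
   degrees are bounded linearly in [M], hence lie in a space of dimension
   [O(M ^ d)]. *)
Lemma mpoly_algebraic_dependence (d : nat) (g : 'I_d.+1 -> {mpoly F[d]}) :
  exists2 P : {mpoly F[d.+1]}, P != 0 & mmap (@mpolyC d F) g P = 0.
Proof.
pose G := (\sum_i msize (g i))%N.
(* The products [ga a] have size at most [D], and [D <= c * M]. Hence
   [D ^ d <= c ^ d * M ^ d < M ^ d.+1], which is why [M] exceeds [c ^ d]. *)
pose c := (d.+1 * G).+1; pose M := (c ^ d).+1; pose D := (d.+1 * (M * G)).+1.
pose A := {ffun 'I_d.+1 -> 'I_M}.
pose mon (a : A) : 'X_{1..d.+1} := [multinom (a i : nat) | i < d.+1].
pose ga (a : A) : {mpoly F[d]} := \prod_i g i ^+ a i.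
have gsize a : (msize (ga a) <= D)%N.
  have Ggi i : (msize (g i) <= G)%N by rewrite /G (bigD1 i) //= leq_addr.
  have pow i : (msize (g i ^+ a i) <= (M * G).+1)%N.
    rewrite -[a i : nat]card_ord -prodr_const.
    apply: leq_trans (@msize_prod_leq _ _ _ (fun=> G) _ _) _.
      by move=> j; apply: leqW.
    by rewrite sum_nat_const card_ord ltnS leq_mul2r ltnW ?orbT.
  apply: leq_trans (@msize_prod_leq _ _ _ (fun=> (M * G)%N) _ pow) _.
  by rewrite sum_nat_const card_ord.
pose K : 'M[F]_(#|{: A}|, #|{: 'X_{1..d < D}}|) :=
  \matrix_(a, b) (ga (enum_val a))@_(enum_val b : 'X_{1..d < D}).
have cardAB : (#|{: 'X_{1..d < D}}| < #|{: A}|)%N.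
  apply: leq_ltn_trans (card_bmultinom_leq _ _) _.
  rewrite card_ffun !card_ord.
  have DcM : (D <= c * M)%N.
    apply: (@leq_add 1 _ M) => //; by rewrite mulnCA mulnC.
  have leq_expn e x y : (x <= y -> x ^ e <= y ^ e)%N by case: e => // e; rewrite leq_exp2r.
  apply: leq_ltn_trans (leq_expn _ _ _ DcM) _.
  by rewrite expnMn expnS ltn_pmul2r ?expn_gt0.
have : kermx K != 0.
  rewrite kermx_eq0 /row_free ltn_eqF //; exact: leq_ltn_trans (rank_leq_col K) _.
rewrite -nz_row_eq0; set v := nz_row _ => v0.
have vK : v *m K = 0 by apply/sub_kermxP; apply: nz_row_sub.
pose P : {mpoly F[d.+1]} := \sum_a v 0 a *: 'X_[mon (enum_val a)].
have mon_inj : injective mon.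
  move=> a b /mnmP ab; apply/ffunP => i; apply: val_inj.
  by have := ab i; rewrite !mnmE.
exists P.
  case/rV0Pn: v0 => a va; apply: contraNneq va => P0.
  have := congr1 (mcoeff (mon (enum_val a))) P0.
  rewrite raddf_sum mcoeff0 (bigD1 a) //= mcoeffZ mcoeffX eqxx mulr1.
  rewrite big1 ?addr0 => [->//|b ba].
  rewrite mcoeffZ mcoeffX (inj_eq mon_inj) (inj_eq enum_val_inj) (negbTE ba).
  by rewrite mulr0.
have -> : mmap (@mpolyC d F) g P = \sum_a v 0 a *: ga (enum_val a).
  rewrite raddf_sum; apply: eq_bigr => a _; rewrite /= mmapZ mmapX mul_mpolyC.
  by congr (_ *: _); apply: eq_bigr => i _; rewrite mnmE.
apply/mpolyP => m; rewrite raddf_sum mcoeff0.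
have [mD|Dm] := ltnP (mdeg m) D; last first.
  apply: big1 => a _; rewrite /= mcoeffZ memN_msupp_eq0 ?mulr0 //.
  exact/msize_mdeg_ge/(leq_trans (gsize _)).
have := congr1 (fun w : 'rV_ _ => w 0 (enum_rank (BMultinom mD))) vK.
rewrite !mxE => vKm; rewrite -[RHS]vKm; apply: eq_bigr => a _.
by rewrite /= mcoeffZ !mxE enum_rankK.
Qed.

End AlgebraicDependence.

(** * Independent functions from chains of irreducible closed sets *)

Lemma zclosed_zeros (F : fieldType) (N : nat) (p : {mpoly F[N]}) :
  zclosed (fun v => p.@[v] = 0).
Proof. by exists (eq p) => v; split=> [p0 q <-|]; last exact. Qed.

(** The function [q] added at each stage vanishes on the previous set but not on the next. In a
    relation [Q(f', q) = 0] on the next set, restriction to the previous one kills the constant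
    term, by independence of [f']; irreducibility then allows division by [q], and the argument
    repeats. *)
Lemma chain_algebraic_independence (F : fieldType) (N l : nat)
    (Z : nat -> pt F N -> Prop) :
  (forall i, (i <= l)%N -> zclosed (Z i) /\ irreducible_set (Z i)) ->
  (forall i, (i < l)%N -> subset_strict (Z i) (Z i.+1)) ->
  exists f : 'I_l -> {mpoly F[N]}, forall P : {mpoly F[l]},
    (forall v, Z l v -> (mmap (@mpolyC N F) f P).@[v] = 0) -> P = 0.
Proof.
elim: l => [|l IHl] Zirr Zstrict.
  exists (fun _ => 0) => P; have [_ [[v Zv] _]] := Zirr 0 (leqnn _).
  have -> : P = (P@_0)%:MP.
    apply: msize1_polyC; rewrite msizeE; apply/bigmax_leqP_seq => m _ _.
    by rewrite mdegE big_ord0.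
  by move/(_ v Zv); rewrite mmapC mevalC => ->; rewrite mpolyC0.
have [//||f' indep] := IHl.
- by move=> i il; apply: Zirr; apply: leqW.
- by move=> i il; apply: Zstrict; apply: leqW.
have [sub [w [Zw nZw]]] := Zstrict l (ltnSn _).
have [[S SE] _] := Zirr l (leqnSn _).
have [_ [_ irr]] := Zirr l.+1 (leqnn _).
have [q [Sq qw]] : exists q, S q /\ q.@[w] <> 0.
  apply: NNPP => noq; apply: nZw; apply/SE => q Sq; apply: NNPP => qw.
  by apply: noq; exists q.
have q0 v : Z l v -> q.@[v] = 0 by move/SE; apply.
pose comp Q := (map_poly (mmap (@mpolyC N F) f') Q).[q].
have compP : forall Q, (forall v, Z l.+1 v -> (comp Q).@[v] = 0) -> Q = 0.
  apply: poly_ind => [//|Q c IHQ].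
  have compE v : (comp (Q * 'X + c%:P)).@[v] =
      (comp Q).@[v] * q.@[v] + (mmap (@mpolyC N F) f' c).@[v].
    by rewrite /comp rmorphD rmorphM /= map_polyX map_polyC /= !hornerE mevalD mevalM.
  move=> Q0; have c0 : c = 0.
    apply: indep => v Zv; have := Q0 v (sub v Zv).
    by rewrite compE q0 // mulr0 add0r.
  suff -> : Q = 0 by rewrite c0 mul0r addr0.
  have [v Zv|all0|all0] := irr _ _ (zclosed_zeros (comp Q)) (zclosed_zeros q).
  - have /eqP := Q0 v Zv; rewrite compE c0 mmap0 meval0 addr0 mulf_eq0.
    by case/orP => /eqP; [left|right].
  - exact: IHQ.
  - by have := all0 w Zw.
exists (fun i => if unlift ord_max i is Some j then f' j else q) => P P0.
apply: muni_eq0; apply: compP => v Zv; rewrite -(P0 v Zv).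
rewrite mmap_muni unlift_none; congr (_.@[v]); congr (_.[_]).
apply: eq_map_poly => r; apply: eq_bigr => m _; congr (_ * _); apply: mmap1_eq => i.
have -> : widen i = lift ord_max i by apply: val_inj; rewrite /= /bump leqNgt ltn_ord.
by rewrite liftK.
Qed.

(** * Sets with a dense polynomial parametrization *)

Section DominantParametrization.

Variables (F : closedFieldType) (N d : nat) (psi : 'I_N -> {mpoly F[d]}).

Definition param_pt (x : pt F d) : pt F N := fun i => (psi i).@[x].

(** [X] is the whole parameter space for the variety, and a [flag] for each member of the chain. If
    [p] and [q] show at [x] and [y] that neither closed set contains [Z], both restrict to nonzero
    univariate polynomials on the line through [x] and [y]; a common nonroot gives a point of [Z]
    outside both sets. *)
Lemma param_irreducible (X : pt F d -> Prop) (Z : pt F N -> Prop) :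
  (exists x, X x) ->
  (forall x y s, X x -> X y -> X (fun i => x i + s * (y i - x i))) ->
  (forall x, X x -> Z (param_pt x)) ->
  (forall p, (forall x, X x -> p.@[param_pt x] = 0) -> forall v, Z v -> p.@[v] = 0) ->
  irreducible_set Z.
Proof.
move=> [x0 Xx0] Xline XZ dense; split; first by exists (param_pt x0); apply: XZ.
have separate B : zclosed B -> ~ (forall v, Z v -> B v) ->
    exists p x, [/\ forall v, B v -> p.@[v] = 0, X x & p.@[param_pt x] <> 0].
  move=> [S SE] nZB; apply: NNPP => nosep; apply: nZB => v Zv; apply/SE => p Sp.
  apply: dense Zv => x Xx; apply: NNPP => px; apply: nosep; exists p, x.
  by split=> // u /SE; apply.
move=> B C Bcl Ccl BC; apply: NNPP => /not_or_and [nB nC].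
have [p [x [pB Xx px]]] := separate _ Bcl nB.
have [q [y [qC Xy qy]]] := separate _ Ccl nC.
have [rp rpE] := meval_line (mmap (@mpolyC d F) psi p) x (fun i => y i - x i).
have [rq rqE] := meval_line (mmap (@mpolyC d F) psi q) x (fun i => y i - x i).
have : rp * rq != 0.
  rewrite mulf_neq0 //.
    apply: contra_not_neq px => rp0; have := rpE 0.
    rewrite rp0 horner0 meval_mmap => /esym E; rewrite -[RHS]E.
    apply: meval_eq => i; apply: meval_eq => j; by rewrite mul0r addr0.
  apply: contra_not_neq qy => rq0; have := rqE 1.
  rewrite rq0 horner0 meval_mmap => /esym E; rewrite -[RHS]E.
  apply: meval_eq => i; apply: meval_eq => j; by rewrite mul1r addrC subrK.
case/closed_nonrootP => s; rewrite rootE hornerM rpE rqE !meval_mmap.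
by have [/pB|/qC] := BC _ (XZ _ (Xline x y s Xx Xy)) => ->; rewrite ?mul0r ?mulr0 eqxx.
Qed.

Lemma param_chain_length (Z : pt F N -> Prop) (C : nat -> pt F N -> Prop) :
  (forall p, (forall x, p.@[param_pt x] = 0) -> forall v, Z v -> p.@[v] = 0) ->
  ~ irr_chain Z d.+1 C.
Proof.
move=> dense [Cirr Cstrict].
have [i il|f indep] := chain_algebraic_independence _ Cstrict.
  by have [? []] := Cirr i il.
have [P P0 gP] := mpoly_algebraic_dependence (fun i => mmap (@mpolyC d F) psi (f i)).
move/negP: P0; apply; apply/eqP/indep => v Cv; apply: dense.
  by move=> x; rewrite -meval_mmap mmap_mmap gP meval0.
by have [_ [_]] := Cirr d.+1 (leqnn _); apply.
Qed.

End DominantParametrization.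

(** * Jets as matrices of polynomials *)

Section Jets.

Variables m n k : nat.

Definition jet_poly (R : nzRingType) (c : 'I_k -> R) : {poly R} :=
  \sum_(l < k) c l *: 'X^l.

Lemma coef_jet_poly (R : nzRingType) (c : 'I_k -> R) (l : 'I_k) :
  (jet_poly c)`_l = c l.
Proof.
rewrite coef_sum (bigD1 l) //= coefZ coefXn eqxx mulr1 big1 ?addr0 // => i il.
by rewrite coefZ coefXn eq_sym (inj_eq val_inj) (negbTE il) mulr0.
Qed.

Lemma eqmodX_jet_poly (R : nzRingType) (c : 'I_k -> R) (p : {poly R}) :
  (forall l : 'I_k, c l = p`_l) -> eqmodX k (jet_poly c) p.
Proof. by move=> cp l lk; rewrite (coef_jet_poly _ (Ordinal lk)) cp. Qed.

Lemma map_jet_poly (R S : nzRingType) (g : {rmorphism R -> S}) (c : 'I_k -> R) :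
  map_poly g (jet_poly c) = jet_poly (g \o c).
Proof.
by rewrite rmorph_sum; apply: eq_bigr => l _; rewrite /= map_polyZ map_polyXn.
Qed.

Definition jet_mx (R : nzRingType) (v : 'I_(nvars m n k) -> R) : 'M[{poly R}]_(m, n) :=
  \matrix_(i, j) jet_poly (fun l => v (enum_rank (i, j, l))).

(** Coefficients from [k] on are discarded, so entries of any degree are allowed, and [jet_mx] after
    [jet_pt] is the identity only modulo ['X^k]. *)
Definition jet_pt (R : nzRingType) (M : 'M[{poly R}]_(m, n)) : 'I_(nvars m n k) -> R :=
  fun t => let ijl := enum_val t in (M ijl.1.1 ijl.1.2)`_ijl.2.

Lemma jet_ptE (R : nzRingType) (M : 'M[{poly R}]_(m, n)) i j (l : 'I_k) :
  jet_pt M (enum_rank (i, j, l)) = (M i j)`_l.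
Proof. by rewrite /jet_pt enum_rankK. Qed.

Lemma jet_mxK (R : nzRingType) (v : 'I_(nvars m n k) -> R) : jet_pt (jet_mx v) =1 v.
Proof.
move=> t; rewrite /jet_pt mxE coef_jet_poly -[in RHS](enum_valK t).
by case: (enum_val t) => -[].
Qed.

Lemma jet_ptK (R : nzRingType) (M : 'M[{poly R}]_(m, n)) i j :
  eqmodX k (jet_mx (jet_pt M) i j) (M i j).
Proof. by rewrite mxE; apply: eqmodX_jet_poly => l; rewrite jet_ptE. Qed.

Lemma map_Xt (F : fieldType) (v : pt F (nvars m n k)) :
  map_mx (map_poly (meval v)) (Xt F m n k) = jet_mx v.
Proof.
apply/matrixP => i j; rewrite !mxE [LHS]map_jet_poly.
by apply: eq_bigr => l _; rewrite /= mevalXU.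
Qed.

Lemma ZjetP (F : fieldType) (v : pt F (nvars m n k)) :
  Zjet m v <->
  forall g : 'I_m -> 'I_n, eqmodX k (\det (colsub g (jet_mx v))) 0.
Proof.
have minorE f g l : ((@minor F m n k m f g)`_l).@[v] = (\det (mxsub f g (jet_mx v)))`_l.
  by rewrite -map_Xt -map_mxsub det_map_mx coef_map.
split=> [Zv|Zv p [f [g [l [_ _ lk ->]]]]].
  apply: (det_colsub_incr (P := fun x => eqmodX k x 0)) => [//|x x0 l lk|g gi l lk].
    by rewrite coefN x0 // coef0 oppr0.
  by rewrite -(minorE id) coef0; apply: Zv; exists id, g, l; split.
rewrite minorE.
(* Selecting rows is left multiplication by a square matrix, so the minor is a multiple of one using
   all rows in order. *)
have -> : mxsub f g (jet_mx v) = rowsub f 1%:M *m colsub g (jet_mx v).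
  by rewrite mul_rowsub_mx mul1mx mxsubrc.
by rewrite det_mulmx (eqmodX_mul0r _ (Zv g) lk) coef0.
Qed.

End Jets.

(** * The parametrization of jets with vanishing maximal minors *)

(* Here [m] is one less than the number of rows of the jet matrices. *)
Section Parametrization.

Variables m n k : nat.
Local Notation a := #|{: 'I_m * 'I_k}|.
Local Notation b := #|{: 'I_m * 'I_n * 'I_k}|.

Definition param_row (R : nzRingType) (x : 'I_(a + b) -> R) : 'rV[{poly R}]_m :=
  \row_i jet_poly (fun l : 'I_k => x (lshift b (enum_rank (i, l)))).

Definition param_block (R : nzRingType) (x : 'I_(a + b) -> R) : 'M[{poly R}]_(m, n) :=
  jet_mx (k := k) (fun t => x (rshift a t)).

Definition param_mx (R : nzRingType) (x : 'I_(a + b) -> R) : 'M[{poly R}]_(1 + m, n) :=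
  col_mx (param_row x *m param_block x) (param_block x).

Lemma map_param_mx (R S : nzRingType) (g : {rmorphism R -> S}) (x : 'I_(a + b) -> R) :
  map_mx (map_poly g) (param_mx x) = param_mx (g \o x).
Proof.
rewrite map_col_mx map_mxM /=.
have -> : map_mx (map_poly g) (param_row x) = param_row (g \o x).
  by apply/matrixP => i j; rewrite !mxE map_jet_poly.
have -> // : map_mx (map_poly g) (param_block x) = param_block (g \o x).
by apply/matrixP => i j; rewrite !mxE map_jet_poly.
Qed.

(* [psi] expresses the coordinates of [param_mx x] as polynomials in the
   parameters [x]. *)
Definition psi (F : fieldType) : 'I_(nvars (1 + m) n k) -> {mpoly F[a + b]} :=
  jet_pt (param_mx (fun t => 'X_t)).

Lemma meval_psi (F : fieldType) (x : pt F (a + b)) t :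
  (psi F t).@[x] = jet_pt (param_mx x) t.
Proof.
have <- : map_mx (map_poly (meval x)) (param_mx (fun t => 'X_t)) = param_mx x.
  rewrite map_param_mx; congr param_mx.
  by apply: functional_extensionality => i; apply: mevalXU.
by rewrite /psi /jet_pt -coef_map /= [in RHS]mxE.
Qed.

Lemma param_mx_surj (R : nzRingType) (w : 'rV[{poly R}]_m) (B : 'M[{poly R}]_(m, n)) :
  exists x, forall i j, eqmodX k (param_mx x i j) (col_mx (w *m B) B i j).
Proof.
exists (fun t : 'I_(a + b) => match split t with
  | inl c => let il : 'I_m * 'I_k := enum_val c in (w 0 il.1)`_il.2
  | inr c => jet_pt B c end) => i j.
set x := fun t => _.
have wE r s : eqmodX k (param_row x r s) (w r s).
  rewrite mxE !ord1; apply: eqmodX_jet_poly => l.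
  by rewrite /x -[lshift _ _]/(unsplit (inl _)) unsplitK enum_rankK.
have BE r s : eqmodX k (param_block x r s) (B r s).
  rewrite mxE; apply: eqmodX_jet_poly => l.
  by rewrite /x -[rshift _ _]/(unsplit (inr _)) unsplitK jet_ptE.
case: (split_ordP i) => i' ->; rewrite ?col_mxEd // !col_mxEu.
exact: eqmodX_mulmx.
Qed.

Lemma psi_in_Zjet (F : closedFieldType) (x : pt F (a + b)) :
  @Zjet F (1 + m) n (1 + m) k (param_pt (@psi F) x).
Proof.
apply/ZjetP => g; set D := colsub g (param_mx x).
have D0 : \det D = 0.
  (* A left kernel vector of [D]: multiplying by the adjugate gives [\det D *: u = 0], and the first
     entry of [u] is 1. *)
  pose u : 'rV[{poly F}]_(1 + m) := row_mx 1%:M (- param_row x).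
  have uD : u *m D = 0.
    have -> : u *m D = colsub g (u *m param_mx x).
      apply/matrixP => i j; rewrite [RHS]mxE mxE [RHS]mxE.
      by apply: eq_bigr => l _; rewrite [D l j]mxE.
    rewrite mul_row_col mul1mx mulNmx subrr.
    by apply/matrixP => i j; rewrite !mxE.
  have := congr1 (fun z : 'rV_ _ => (z *m \adj D) 0 0) uD.
  rewrite -mulmxA mul_mx_adj mul_mx_scalar mul0mx !mxE.
  by case: split_ordP => // i; rewrite ord1 !mxE mulr1.
have -> : param_pt (@psi F) x = jet_pt (param_mx x).
  by apply: functional_extensionality => t; apply: meval_psi.
rewrite -D0; apply: eqmodX_det => i j; rewrite mxE [D i j]mxE; exact: jet_ptK.
Qed.

Lemma psi_dense (F : closedFieldType) (p : {mpoly F[nvars (1 + m) n k]}) :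
  (m < n)%N -> (forall x, p.@[param_pt (@psi F) x] = 0) ->
  forall v, @Zjet F (1 + m) n (1 + m) k v -> p.@[v] = 0.
Proof.
move=> mn px v /ZjetP Zv.
have [E [G [G0 EG]]] := generic_syzygy mn Zv.
have [r rE] := meval_line p v (jet_pt E).
(* Wherever [G] does not vanish, the point of the line lies in the image, so [r] vanishes there.
   Hence [G * r] has no nonroot and must be 0. *)
have Gr : G * r = 0.
  apply/eqP; apply: contraT => /closed_nonrootP [s]; rewrite rootE hornerM mulf_eq0.
  case/norP => /EG [u [u0 uM]] rs; case/negP: rs.
  have [w wM] := syzygy_row_combination u0 uM.
  have [x xE] := param_mx_surj w (dsubmx (jet_mx v + s%:P *: E)).
  rewrite rE -(px x); apply/eqP/meval_eq => t; rewrite /param_pt meval_psi.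
  rewrite -(jet_mxK v t) /jet_pt.
  rewrite xE ?ltn_ord // -wM ?ltn_ord // !mxE.
  by rewrite coefD coefCM.
move/eqP: Gr; rewrite mulf_eq0 (negbTE G0) => /eqP r0.
have := rE 0; rewrite r0 horner0 => ->.
by apply: meval_eq => t; rewrite mul0r addr0.
Qed.

(** * A chain of closures of maximal length *)

(* The parameters of the top row come first: while only they vary, the block
   stays equal to [I 0], so they can be read off the first row of the matrix. *)
Definition base_param (F : fieldType) : pt F (a + b) := fun t =>
  match split t with
  | inl _ => 0
  | inr c => let ijl := enum_val c in
             ((ijl.1.1 == ijl.1.2 :> nat) && (ijl.2 == 0 :> nat))%:R
  end.

Definition flag (F : fieldType) (e : nat) : pt F (a + b) -> Prop :=
  fun x => forall t : 'I_(a + b), (e <= t)%N -> x t = base_param F t.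

(** The Zariski closure of the image of [flag e]. *)
Definition flag_closure (F : closedFieldType) (e : nat) : pt F (nvars (1 + m) n k) -> Prop :=
  zero_set (fun p => forall x, flag e x -> p.@[param_pt (@psi F) x] = 0).

(** The coordinate [c] recovers the parameter freed last, which makes consecutive closures
    distinct. *)
Lemma flag_separation (F : closedFieldType) (t : 'I_(a + b)) : (m < n)%N ->
  exists c : 'I_(nvars (1 + m) n k),
    forall x : pt F (a + b), flag t.+1 x -> param_pt (@psi F) x c = x t.
Proof.
move=> mn; case: (split_ordP t) => c ->; last first.
  pose ijl := enum_val c.
  exists (enum_rank (rshift 1 ijl.1.1, ijl.1.2, ijl.2)) => x _.
  rewrite /param_pt meval_psi jet_ptE col_mxEd mxE coef_jet_poly.
  congr (x (rshift _ _)); rewrite -[RHS]enum_valK; congr enum_rank.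
  by rewrite /ijl; case: (enum_val c) => -[].
pose il := enum_val c; pose h : 'I_m -> 'I_n := widen_ord (ltnW mn).
exists (enum_rank (lshift m (0 : 'I_1), h il.1, il.2)) => x xF.
rewrite /param_pt meval_psi jet_ptE col_mxEu.
have Bx i j : eqmodX k (param_block x i j) ((i == j :> nat)%:R).
  rewrite mxE; apply: eqmodX_jet_poly => l.
  rewrite xF; last by rewrite /= ltn_addr.
  rewrite /base_param -[rshift _ _]/(unsplit (inr _)) unsplitK enum_rankK /=.
  by case: (i == j :> nat); rewrite ?coef1 ?coef0.
have -> : ((param_row x *m param_block x) 0 (h il.1))`_il.2 =
          (param_row x 0 il.1)`_il.2.
  rewrite mxE (@eqmodX_sum _ k _ _ _ _ (fun i => param_row x 0 i * (i == il.1)%:R)) //.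
    by rewrite (bigD1 il.1) //= eqxx mulr1 big1 ?addr0 // => i /negbTE ->; rewrite mulr0.
  by move=> i _; apply: eqmodXM => //; apply: Bx.
rewrite mxE coef_jet_poly; congr (x (lshift _ _)); rewrite -[RHS]enum_valK.
by congr enum_rank; rewrite /il; case: (enum_val c).
Qed.

Lemma flag_chain (F : closedFieldType) : (m < n)%N ->
  irr_chain (@Zjet F (1 + m) n (1 + m) k) (a + b) (@flag_closure F).
Proof.
move=> mn; split=> [i _|i iab].
  split; first by eexists => v; split; apply.
  split.
    apply: (@param_irreducible _ _ _ (@psi F) (@flag F i)).
    - by exists (base_param F).
    - by move=> x y s xF yF t it; rewrite xF // yF // subrr mulr0 addr0.
    - by move=> x xF p; apply.
    - by move=> p px v; apply.
  by move=> v Zv p pI; apply: Zv => x _; apply: psi_in_Zjet.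
split=> [v Zv p px|].
  by apply: Zv => x xF; apply: px => t it; apply: xF; apply: ltnW.
pose t := Ordinal iab; have [c cE] := flag_separation F t mn.
(* Only the parameter [t] leaves its base value, so ['X_c] minus that value is 1 at the image of
   [x1], while it vanishes on the image of [flag t]. *)
pose x1 : pt F (a + b) := fun t' => base_param F t' + (t' == t)%:R.
exists (param_pt (@psi F) x1); split.
  move=> p; apply => t' it'; rewrite /x1.
  by rewrite -(inj_eq val_inj) /= gtn_eqF // addr0.
have x1F : flag t.+1 x1.
  by move=> t' it'; rewrite /x1 -(inj_eq val_inj) /= gtn_eqF // addr0.
move/(_ ('X_c - (base_param F t)%:MP)); rewrite mevalB mevalXU mevalC cE //.
rewrite /x1 eqxx addrAC subrr add0r => H.
have /eqP : (1 : F) = 0; last by rewrite oner_eq0.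
apply: H => x xF; rewrite mevalB mevalXU mevalC cE ?xF ?subrr //.
by move=> t' it'; apply: xF; apply: ltnW.
Qed.

End Parametrization.

(** * Irreducibility and codimension *)

Theorem theorem3p1 (F : closedFieldType) (m n k : nat) :
  (1 <= m)%N -> (m <= n)%N -> (1 <= k)%N ->
  irreducible_set (@Zjet F m n m k) /\
  exists d : nat, zdim (@Zjet F m n m k) d /\ (d + k * (n - m + 1) = m * n * k)%N.
Proof.
case: m => // m _ mn _; split.
  apply: (@param_irreducible _ _ _ (@psi m n k F) (fun _ => True)) => //.
  - by exists (base_param F).
  - by move=> x _; apply: psi_in_Zjet.
  - by move=> p px; apply: psi_dense => // x; apply: px.
exists (#|{: 'I_m * 'I_k}| + #|{: 'I_m * 'I_n * 'I_k}|)%N; split.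
  split; first by exists (@flag_closure m n k F); apply: flag_chain.
  move=> [C chainC]; apply: (@param_chain_length _ _ _ (@psi m n k F)) chainC.
  by move=> p px; apply: psi_dense.
rewrite !card_prod !card_ord.
(* This removes the truncated subtraction. In terms of the decremented [m], the identity is
   [k m + k m n + k (n - m) = (m + 1) n k]. *)
have [q ->] : exists q, n = (m.+1 + q)%N by exists (n - m.+1)%N; rewrite subnKC.
nia.
Qed.
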